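(* There exists a constant $C>0$ that depends only on the loss function $\ell$ and on the constant $M$ (for which $\|f_*\|_\infty\le M$) such that, for all $\varepsilon>0$ and all $\lambda\in\Lambda$, $$\mathcal E(f_{\lambda^\varepsilon})+2\varepsilon\sum_{j\notin\mathrm{supp}(\lambda)}\lambda_j^\varepsilon\le 3\,\mathcal E(f_\lambda)+C\Bigl(\varepsilon^2\alpha_N^2(\lambda)+\frac{\varepsilon}{N}\Bigr).$$
   Context: Setting. $S,T$ are measurable spaces, $(X,Y)$ is a random couple in $S\times T$ with distribution $P$, and $\Pi$ is the distribution of $X$. For a function $g$ on $S\times T$, $Pg=\mathbb E g(X,Y)$. $h_1,\dots,h_N:S\to[-1,1]$ are given measurable functions (the dictionary). $\Lambda=\{(\lambda_1,\dots,\lambda_N):\lambda_j\ge0,\ \sum_{j=1}^N\lambda_j=1\}$, and $f_\lambda=\sum_{j=1}^N\lambda_jh_j$ for $\lambda\in\mathbb R^N$; $\mathrm{supp}(\lambda)=\{j:\lambda_j\ne0\}$. Loss. $\ell:T\times\mathbb R\to\mathbb R_+$ is a loss function such that for every $y\in T$ the function $\ell(y,\cdot)$ is convex and twice differentiable (derivatives $\ell'_u,\ell''_u$ in the second variable), $\ell''_u$ is uniformly bounded on $T\times\mathbb R$, $\sup_{y\in T}\ell(y;0)<\infty$ and $\sup_{y\in T}|\ell'_u(y;0)|<\infty$. For $f:S\to\mathbb R$, $(\ell\bullet f)(x,y):=\ell(y,f(x))$. It is assumed that the infimum of $P(\ell\bullet g)$ over all measurable $g:S\to\mathbb R$ is attained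 at some $f_*\in L_2(\Pi)$ with $\|f_*\|_\infty\le M$ for a constant $M$, and that $\tau(M\vee1)>0$, where $\tau(R):=\frac12\inf_{y\in T}\inf_{|u|\le R}\ell''_u(y,u)$ (without loss of generality $\tau(R)\le 1$ for $R>0$) and $a\vee b=\max(a,b)$. The excess risk is $\mathcal E(f):=P(\ell\bullet f)-P(\ell\bullet f_* )$. Penalized true risk minimizer (with $0\log0=0$): $$\lambda^\varepsilon:=\operatorname*{argmin}_{\lambda\in\Lambda}\Bigl[P(\ell\bullet f_\lambda)+\varepsilon\sum_{j=1}^N\lambda_j\log\lambda_j\Bigr].$$ Alignment coefficient. For $\lambda\in\Lambda$, let $T_\Lambda(\lambda):=\{v\in\mathbb R^N:\exists t>0,\ \lambda+vt\in\Lambda\}$ (the tangent cone of the convex set $\Lambda$ at $\lambda$). For $w\in\mathbb R^N$, $$a_H(\Lambda,\lambda,w):=\sup\{\langle w,u\rangle_{\ell_2}:\ u\in T_\Lambda(\lambda),\ \|f_u\|_{L_2(\Pi)}=1\},$$ where the subscript $H$ refers to the Gram matrix $H=(\langle h_i,h_j\rangle_{L_2(\Pi)})_{i,j=1}^N$, for which $\|f_u\|^2_{L_2(\Pi)}=\langle Hu,u\rangle_{\ell_2}$. Let $s^N(\lambda)\in\mathbb R^N$ have coordinates $s^N_j(\lambda):=\log(eN^2\lambda_j)$ for $j\in\mathrm{supp}(\lambda)$ and $s^N_j(\lambda):=0$ for $j\notin\mathrm{supp}(\lambda)$. Then $\alpha_N(\lambda):=a_H(\Lambda,\lambda,s^N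(\lambda))$.
   Formalization: In the definition of a_H (hence of α_N(λ)) the supremum is taken over u in −T_Λ(λ) instead of u in T_Λ(λ); with the printed sign the inequality fails. *)

(* Defs.v *)
From HB Require Import structures.
From mathcomp Require Import all_boot all_order all_algebra.
From mathcomp Require Import all_classical all_reals all_analysis.

Set Implicit Arguments.
Unset Strict Implicit.
Unset Printing Implicit Defensive.

Import Order.TTheory GRing.Theory Num.Theory.
Import numFieldNormedType.Exports.

Local Open Scope classical_set_scope.
Local Open Scope ring_scope.

Section Loss.
Context (R : realType) (d : measure_display) (T : measurableType d).
Implicit Types l : T -> R -> R.

Definition loss_du l (y : T) : R -> R := derive1 (l y).
Definition loss_duu l (y : T) : R -> R := derive1 (loss_du l y).

(* Joint measurability is what gives a meaning to the expectations
   of l(Y, f(X)). *)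
Record loss_function l : Prop := LossFunction {
  loss_ge0 : forall y u, 0 <= l y u;
  loss_measurable : measurable_fun [set: T * R] (fun z => l z.1 z.2);
  loss_convex : forall y, convex_function [set: R^o] (l y);
  loss_derivable : forall y u, derivable (l y) u 1;
  loss_du_derivable : forall y u, derivable (loss_du l y) u 1;
  loss_duu_bounded : exists B : R, forall y u, `|loss_duu l y u| <= B;
  loss_at0_bounded : has_ubound [set l y 0 | y in [set: T]];
  loss_du_at0_bounded : has_ubound [set `|loss_du l y 0| | y in [set: T]]
}.

Definition tau l (r : R) : R :=
  2^-1 * inf [set loss_duu l z.1 z.2 | z in [set z : T * R | `|z.2| <= r]].

End Loss.

Section Risk.
Context (R : realType) (dO dS dT : measure_display).
Context (Omega : measurableType dO) (S : measurableType dS)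
        (T : measurableType dT) (Pr : probability Omega R).
Variables (X : {RV Pr >-> S}) (Y : {RV Pr >-> T}) (l : T -> R -> R).
Local Open Scope ereal_scope.

(* P (l . f) = E l(Y, f(X)), possibly +oo. *)
Definition risk (f : S -> R) : \bar R :=
  'E_Pr[fun w => l (Y w) (f (X w))].

Definition risk_minimizer (fstar : S -> R) : Prop :=
  measurable_fun [set: S] fstar /\
  forall g : S -> R, measurable_fun [set: S] g -> risk fstar <= risk g.

Definition excess_risk (fstar f : S -> R) : \bar R := risk f - risk fstar.

End Risk.

Section Simplex.
Context (R : realType) (N : nat).
Implicit Types (la u w : 'rV[R]_N) (K : set 'rV[R]_N).

Definition simplex : set 'rV[R]_N :=
  [set la | (forall j, 0 <= la 0 j) /\ \sum_j la 0 j = 1].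

Definition supp la : {set 'I_N} := [set j | la 0 j != 0]%SET.

Definition entropy la : R := \sum_j la 0 j * ln (la 0 j).

Definition dotv w u : R := \sum_j w 0 j * u 0 j.

Definition tangent_cone K la : set 'rV[R]_N :=
  [set v | exists2 t : R, 0 < t & K (la + t *: v)].

Definition sN la : 'rV[R]_N :=
  \row_j (if j \in supp la then ln (expR 1 * N%:R ^+ 2 * la 0 j) else 0).

End Simplex.
Arguments simplex {R N}.

Section Dictionary.
Context (R : realType) (dS : measure_display) (S : measurableType dS) (N : nat).
Variable h : 'I_N -> {mfun S >-> R}.

Definition mixture (la : 'rV[R]_N) (x : S) : R := \sum_j la 0 j * h j x.

Section Alignment.
Variable Pi : {measure set S -> \bar R}.
Local Open Scope ereal_scope.

(* The supremum runs over directions u with -u in the tangent cone of K at la,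
   i.e. over multiples of la - mu with mu in K.  The sign matters: with u
   itself in the tangent cone the oracle inequality fails.  Indeed, take
   the loss l(y, u) = u^2, fstar = 0, h_j = -1/N for j < N, h_N = (N - 1)/N,
   eps = 1/N and la = (1, 0, ..., 0); the penalized minimizer is then uniform,
   so the left-hand side is 2 (N - 1)/N^2, whereas the right-hand side is
   (3 + C (ln^2(e N^2) + 1))/N^2.

   The supremum is taken in \bar R: it is -oo when no direction has unit norm,
   in which case its square is +oo. *)
Definition alignment (K : set 'rV[R]_N) (la w : 'rV[R]_N) : \bar R :=
  ereal_sup [set (dotv w u)%:E | u in
    [set u | tangent_cone K la (- u)%R /\
             'N[Pi]_2%:E[EFin \o mixture u] = 1]].

Definition alphaN (la : 'rV[R]_N) : \bar R := alignment simplex la (sN la).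

End Alignment.

Section PenalizedRisk.
Context (dO dT : measure_display) (Omega : measurableType dO)
        (T : measurableType dT) (Pr : probability Omega R).
Variables (X : {RV Pr >-> S}) (Y : {RV Pr >-> T}) (l : T -> R -> R).
Local Open Scope ereal_scope.

Definition penalized_risk (eps : R) (la : 'rV[R]_N) : \bar R :=
  risk X Y l (mixture la) + (eps * entropy la)%:E.

Definition penalized_minimizer (eps : R) (la : 'rV[R]_N) : Prop :=
  simplex la /\
  forall mu, simplex mu -> penalized_risk eps la <= penalized_risk eps mu.

End PenalizedRisk.

End Dictionary.

(* Main.v *)
(* Compare the penalized minimizer mu with the midpoint m of mu and la, instead
   of differentiating the risk L(nu) = P(l . f_nu) at mu.  On [-1, 1] the loss is
   strongly convex, so 2 L(m) + (tau / 2) ||f_(la - mu)||^2 <= L(la) + L(mu);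
   with the minimality of mu,
     L(mu) + (tau / 2) ||f_(la - mu)||^2 <= L(la) + 2 eps (H(m) - H(mu))
   where H is the entropy sum.  Convexity of x ln x on supp la, and a direct
   bound off supp la, give
     2 (H(m) - H(mu)) <=
       <s^N(la), la - mu> - 2 sum_(j notin supp la) mu_j + 2 / N.
   As la - mu points against the tangent cone at la, the scalar product is at
   most alpha_N(la) ||f_(la - mu)||, which the quadratic term absorbs.
   Infinite risks or an infinite alignment coefficient make the inequality
   trivial. *)
Require Import Defs.
From HB Require Import structures.
From mathcomp Require Import all_boot all_order all_algebra.
From mathcomp Require Import all_classical all_reals all_analysis.
From mathcomp Require Import measurable_realfun ring lra.

Set Implicit Arguments.
Unset Strict Implicit.
Unset Printing Implicit Defensive.

Import Order.TTheory GRing.Theory Num.Theory.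
Import numFieldNormedType.Exports.

Local Open Scope classical_set_scope.
Local Open Scope ring_scope.


(** * Strong convexity of the loss at midpoints *)

Lemma mean_value (R : realType) (f df : R -> R) (a b : R) :
  (forall x : R, is_derive x 1 f (df x)) -> a < b ->
  exists2 c, a < c < b & f b - f a = df c * (b - a).
Proof.
move=> fdf ab; have [|c cab ->] := MVT ab (fun x _ => fdf x).
  by apply: derivable_within_continuous => x _; apply: ex_derive.
by exists c => //; move: cab; rewrite in_itv.
Qed.

(** The mean value theorem on the two halves gives slopes [df c1] and [df c2] with [c1 < c2]; a
    third application, to [df], orders them. *)
Lemma midpoint_convex (R : realType) (f df ddf : R -> R) (a b : R) :
  (forall x : R, is_derive x 1 f (df x)) ->
  (forall x : R, is_derive x 1 df (ddf x)) ->
  a < b -> (forall x, a < x < b -> 0 <= ddf x) ->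
  2 * f ((a + b) / 2) <= f a + f b.
Proof.
move=> fdf dfddf ab ddf0; set m := (a + b) / 2.
have am : a < m by rewrite /m; lra.
have mb : m < b by rewrite /m; lra.
have [c1 /andP[ac1 c1m] e1] := mean_value fdf am.
have [c2 /andP[mc2 c2b] e2] := mean_value fdf mb.
have [c /andP[c1c cc2] e] := mean_value dfddf (lt_trans c1m mc2).
have ddfc0 : 0 <= ddf c by apply: ddf0; lra.
have d0 : 0 <= df c2 - df c1 by rewrite e mulr_ge0// subr_ge0; lra.
have mab : m - a = (b - a) / 2 by rewrite /m; lra.
have bmab : b - m = (b - a) / 2 by rewrite /m; lra.
have : 0 <= (df c2 - df c1) * ((b - a) / 2) by rewrite mulr_ge0//; lra.
rewrite mab in e1; rewrite bmab in e2.
by rewrite mulrBl -e1 -e2; lra.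
Qed.

(** Subtracting [t * x ^+ 2] leaves a second derivative that is nonnegative on the segment; the
    parallelogram identity for the square gives back the quadratic term. *)
Lemma midpoint_strongly_convex (R : realType) (f df ddf : R -> R) (t a b : R) :
  (forall x : R, is_derive x 1 f (df x)) ->
  (forall x : R, is_derive x 1 df (ddf x)) ->
  a < b -> (forall x, a < x < b -> 2 * t <= ddf x) ->
  2 * f ((a + b) / 2) + t / 2 * (a - b) ^+ 2 <= f a + f b.
Proof.
move=> fdf dfddf ab ddft.
pose g (x : R) := f x - t * x ^+ 2.
have gdg (x : R) : is_derive x 1 g (df x - 2 * t * x).
  rewrite /g; apply: is_deriveB; apply: is_derive_eq.
  by rewrite /GRing.scale/=; ring.
have dgddg (x : R) :
    is_derive x 1 (fun x : R => df x - 2 * t * x) (ddf x - 2 * t).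
  by apply: is_deriveB; apply: is_derive_eq; rewrite /GRing.scale/=; ring.
have : 2 * g ((a + b) / 2) <= g a + g b.
  by apply: (midpoint_convex gdg dgddg ab) => x xab; rewrite subr_ge0 ddft.
by rewrite /g; lra.
Qed.

Lemma loss_midpoint (R : realType) (dT : measure_display)
    (T : measurableType dT) (l : T -> R -> R) (r : R) (y : T) (a b : R) :
  loss_function l -> `|a| <= r -> `|b| <= r ->
  2 * l y ((a + b) / 2) + tau l r / 2 * (a - b) ^+ 2 <= l y a + l y b.
Proof.
move=> lossl.
wlog ab : a b / a < b.
  move=> wl ar br; have [ab|ba|->] := ltgtP a b; first exact: wl.
    by rewrite [a + b]addrC [leRHS]addrC -sqrrN opprB; exact: wl.
  by rewrite subrr expr0n mulr0 addr0 (_ : (b + b) / 2 = b); lra.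
move=> ar br.
apply: (@midpoint_strongly_convex _ _ (loss_du l y) (loss_duu l y)) => //.
- move=> x; apply: DeriveDef; first exact: loss_derivable.
  by rewrite /loss_du derive1E.
- move=> x; apply: DeriveDef; first exact: loss_du_derivable.
  by rewrite /loss_duu derive1E.
move=> x /andP[ax xb]; rewrite /tau mulrA divff ?mul1r//.
have [B Bl] := loss_duu_bounded lossl.
(* [inf] bounds from below only a set that has a lower bound, here [- B]. *)
apply: ge_inf.
  exists (- B) => _ [z _ <-]; have := Bl z.1 z.2.
  by rewrite ler_norml => /andP[].
exists (y, x) => //=; move: ar br; rewrite !ler_norml.
by move=> /andP[? ?] /andP[? ?]; apply/andP; split; lra.
Qed.

(** * Entropy at the midpoint *)

Lemma mulr_ln_ratio_le (R : realType) (a b : R) : 0 < a -> 0 < b ->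
  b * (ln a - ln b) <= a - b.
Proof.
move=> a0 b0; have : ln (1 + (a / b - 1)) <= a / b - 1.
  by apply: le_ln1Dx; rewrite ltrBrDr addNr divr_gt0.
rewrite addrC subrK ln_div// => /(ler_wpM2l (ltW b0)) /le_trans; apply.
by rewrite mulrBr mulr1 mulrCA divff ?gt_eqF// mulr1.
Qed.

(** The first term on the right cancels when summed over two points of the simplex. For [a != 0] it
    turns the logarithm into [1 + ln a], the derivative of [z * ln z] at [a]. *)
Lemma entropy_midpoint_coord (R : realType) (n a x : R) :
  0 < n -> 0 <= a -> 0 <= x ->
  2 * ((a + x) / 2 * ln ((a + x) / 2) - x * ln x) <=
  (a - x) * (1 - ln (expR 1 * n ^+ 2))
    + (if a != 0 then ln (expR 1 * n ^+ 2 * a) else 0) * (a - x)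
    - 2 * (if a == 0 then x else 0) + 2 / n ^+ 2.
Proof.
move=> n0 a0 x0; set m := (a + x) / 2; set K := expR 1 * n ^+ 2.
have n20 : 0 < n ^+ 2 by rewrite exprn_gt0.
have n2V0 : 0 <= 2 / n ^+ 2 by rewrite divr_ge0// ltW.
have K0 : 0 < K by rewrite mulr_gt0// expR_gt0.
have lnK : ln K = 1 + 2 * ln n.
  by rewrite lnM ?posrE ?expR_gt0// expRK lnXn// mulr_natl.
have [a_eq0|an0] := eqVneq a 0; last first.
  have {}a0 : 0 < a by rewrite lt_neqAle eq_sym an0.
  have m0 : 0 < m by rewrite /m; lra.
  (* The graph of [z * ln z] lies above its tangent at [m]. *)
  have tangent : m * ln m - x * ln x <= (ln m + 1) * (m - x).
    have [->|xn0] := eqVneq x 0; first by rewrite mul0r !subr0; lra.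
    have {}x0 : 0 < x by rewrite lt_neqAle eq_sym xn0.
    by have := mulr_ln_ratio_le m0 x0; lra.
  (* As [m] lies between [a] and [x], the factors [a - x] and [ln m - ln a] have opposite signs. *)
  have slope : (a - x) * ln m <= (a - x) * ln a.
    have [xa|ax] := leP x a.
      by rewrite ler_wpM2l ?subr_ge0// ler_ln ?posrE// /m; lra.
    by rewrite ler_wnM2l ?subr_le0 ?(ltW ax)// ler_ln ?posrE// /m; lra.
  rewrite /= lnM ?posrE//.
  have e : 2 * (m - x) = a - x by rewrite /m; lra.
  have : 2 * (m * ln m - x * ln x) <= (ln m + 1) * (a - x).
    by rewrite -e mulrCA ler_pM2l.
  by lra.
rewrite /= a_eq0 /m a_eq0 add0r sub0r !mul0r.
have [->|xn0] := eqVneq x 0; first by rewrite !mul0r mulr0; lra.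
have {}x0 : 0 < x by rewrite lt_neqAle eq_sym xn0.
rewrite ln_div ?posrE// lnK.
have ln2 : 1 / 2 <= ln 2 :> R.
  by have := @mulr_ln_ratio_le R 1 2 ltr01 (ltr0Sn _ _); rewrite ln1; lra.
(* The concave [- x * ln x] is bounded by its tangent at [2 / n ^+ 2], which leaves exactly that
   remainder; the rest is [x <= 2 * x * ln 2]. *)
have := @mulr_ln_ratio_le R (2 / n ^+ 2) x (divr_gt0 (ltr0Sn _ _) n20) x0.
rewrite ln_div ?posrE// lnXn//.
have := ler_wpM2l (ltW x0) ln2. 
lra.
Qed.

Lemma entropy_midpoint (R : realType) (N : nat) (la mu : 'rV[R]_N) :
  simplex la -> simplex mu ->
  2 * (entropy (2^-1 *: (la + mu)) - entropy mu) <=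
  dotv (sN la) (la - mu) - 2 * (\sum_(j | j \notin supp la) mu 0 j) + 2 / N%:R.
Proof.
move=> [la0 la1] [mu0 mu1].
have N0 : 0 < N%:R :> R.
  rewrite ltr0n lt0n; apply/eqP => N_eq0; subst N.
  by move: la1; rewrite big_ord0 => /eqP; rewrite eq_sym oner_eq0.
have -> : 2 / N%:R = \sum_(j < N) 2 / N%:R ^+ 2 :> R.
  by rewrite sumr_const card_ord -[_ *+ N]mulr_natr; field; rewrite gt_eqF.
pose c : R := 1 - ln (expR 1 * N%:R ^+ 2).
have addc0 z : z = \sum_j (la 0 j - mu 0 j) * c + z.
  by rewrite -mulr_suml sumrB la1 mu1 subrr mul0r add0r.
rewrite /entropy /dotv (big_mkcond (fun j => j \notin supp la))/= -sumrB.
rewrite !mulr_sumr -sumrB -big_split/=.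
rewrite [leRHS]addc0 -big_split/= ler_sum// => j _.
have := entropy_midpoint_coord N0 (la0 j) (mu0 j).
rewrite /= -/c !mxE inE [2^-1 * _]mulrC => /le_trans; apply.
by rewrite negbK; lra.
Qed.

(** * Mixtures, the Gram seminorm and the alignment coefficient *)

Lemma simplex_convex (R : realType) (N : nat) (p : R) (la mu : 'rV[R]_N) :
  0 <= p <= 1 -> simplex la -> simplex mu ->
  simplex ((1 - p) *: la + p *: mu).
Proof.
move=> /andP[p0 p1] [la0 la1] [mu0 mu1]; split.
  by move=> j; rewrite !mxE addr_ge0// mulr_ge0// subr_ge0.
under eq_bigr do rewrite !mxE.
by rewrite big_split/= -!mulr_sumr la1 mu1 !mulr1 subrK.
Qed.

Lemma dotvDZr (R : realType) (N : nat) (w u v : 'rV[R]_N) (k : R) :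
  dotv w (u + k *: v) = dotv w u + k * dotv w v.
Proof.
rewrite /dotv mulr_sumr -big_split/=; apply: eq_bigr => j _.
by rewrite !mxE; ring.
Qed.

Lemma mixtureDZ (R : realType) (dS : measure_display) (S : measurableType dS)
    (N : nat) (h : 'I_N -> {mfun S >-> R}) (u v : 'rV[R]_N) (k : R) (x : S) :
  mixture h (u + k *: v) x = mixture h u x + k * mixture h v x.
Proof.
rewrite /mixture mulr_sumr -big_split/=; apply: eq_bigr => j _.
by rewrite !mxE; ring.
Qed.

Lemma mixture_le1 (R : realType) (dS : measure_display) (S : measurableType dS)
    (N : nat) (h : 'I_N -> {mfun S >-> R}) (la : 'rV[R]_N) (x : S) :
  (forall j x, `|h j x| <= 1) -> simplex la -> `|mixture h la x| <= 1.
Proof.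
move=> h1 [la0 <-]; apply: le_trans (ler_norm_sum _ _ _) _.
by apply: ler_sum => j _; rewrite normrM ger0_norm// ler_piMr.
Qed.

Lemma measurable_mixture (R : realType) (dS : measure_display)
    (S : measurableType dS) (N : nat) (h : 'I_N -> {mfun S >-> R})
    (la : 'rV[R]_N) :
  measurable_fun [set: S] (mixture h la).
Proof. by apply: measurable_sum => j; apply: measurable_funM. Qed.

(** The quadratic form of the Gram matrix. It may vanish at a nonzero [u]. *)
Definition sqnorm (R : realType) (dS : measure_display) (S : measurableType dS)
    (N : nat) (h : 'I_N -> {mfun S >-> R}) (Pi : {measure set S -> \bar R})
    (u : 'rV[R]_N) : \bar R :=
  (\int[Pi]_x (mixture h u x ^+ 2)%:E)%E.

Lemma Lnorm2_eq1 (R : realType) (dS : measure_display) (S : measurableType dS)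
    (N : nat) (h : 'I_N -> {mfun S >-> R}) (Pi : {measure set S -> \bar R})
    (u : 'rV[R]_N) :
  ('N[Pi]_2%:E[EFin \o mixture h u] = 1 <-> sqnorm h Pi u = 1)%E.
Proof.
have sqE : sqnorm h Pi u = (\int[Pi]_x (`|(EFin \o mixture h u) x| `^ 2))%E.
  by apply: eq_integral => x _ /=; rewrite powR_mulrn// real_normK// num_real.
split=> [e|]; last by rewrite unlock -sqE => ->; rewrite poweR1r.
by rewrite sqE -poweR_Lnorm// e poweR1r.
Qed.

Lemma sqnormZ (R : realType) (dS : measure_display) (S : measurableType dS)
    (N : nat) (h : 'I_N -> {mfun S >-> R}) (Pi : {measure set S -> \bar R})
    (u : 'rV[R]_N) (k : R) :
  sqnorm h Pi (k *: u) = ((k ^+ 2)%:E * sqnorm h Pi u)%E.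
Proof.
rewrite /sqnorm -ge0_integralZl_EFin ?sqr_ge0//.
- apply: eq_integral => x _; rewrite -EFinM -exprMn; congr (_ ^+ 2)%:E.
  rewrite -[k *: u]add0r mixtureDZ [X in X + _](_ : _ = 0) ?add0r//.
  by apply: big1 => j _; rewrite mxE mul0r.
- by move=> x _; rewrite lee_fin sqr_ge0.
- apply/measurable_EFinP; apply: measurable_funX; exact: measurable_mixture.
Qed.

(** A mixture of zero seminorm vanishes almost everywhere, so the two integrands agree almost
    everywhere. *)
Lemma sqnormD_null (R : realType) (dS : measure_display)
    (S : measurableType dS) (N : nat) (h : 'I_N -> {mfun S >-> R})
    (Pi : {measure set S -> \bar R}) (u v : 'rV[R]_N) (k : R) :
  sqnorm h Pi u = 0%E -> sqnorm h Pi (v + k *: u) = sqnorm h Pi v.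
Proof.
have msq w : measurable_fun setT (fun x => (mixture h w x ^+ 2)%:E).
  by apply/measurable_EFinP; apply: measurable_funX; exact: measurable_mixture.
move=> u0; apply: ae_eq_integral => //.
have : ae_eq Pi setT (fun x => (mixture h u x ^+ 2)%:E) (cst 0%E).
  apply/ae_eq_integral_abs => //; rewrite -[RHS]u0; apply: eq_integral => x _.
  by rewrite gee0_abs// lee_fin sqr_ge0.
apply: filterS => x ux Tx; have [/eqP] := ux Tx.
by rewrite sqrf_eq0 mixtureDZ => /eqP ->; rewrite mulr0 addr0.
Qed.

(** For [0 < c] the normalized [la - mu] competes in the supremum: a step [c] against it leads from
    [la] to [mu]. For [c = 0] a positive product would contradict the finiteness of the supremum. *)
Lemma alignment_ub (R : realType) (dS : measure_display)
    (S : measurableType dS) (N : nat) (h : 'I_N -> {mfun S >-> R})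
    (Pi : {measure set S -> \bar R}) (la mu w : 'rV[R]_N) (a c : R) :
  simplex la -> simplex mu -> 0 <= c ->
  alignment h Pi simplex la w = a%:E ->
  sqnorm h Pi (la - mu) = (c ^+ 2)%:E ->
  dotv w (la - mu) <= a * c.
Proof.
move=> sla smu; rewrite le_eqVlt => /predU1P[<-|c0] alE uc; last first.
  have : ((dotv w (c^-1 *: (la - mu)))%:E <= a%:E)%E.
    rewrite -alE; apply: ereal_sup_ubound; exists (c^-1 *: (la - mu)) => //.
    split; last first.
      apply/Lnorm2_eq1; rewrite sqnormZ uc -EFinM -exprMn mulVf ?gt_eqF//.
      by rewrite expr1n.
    exists c => //.
    by rewrite -scalerN scalerA divff ?gt_eqF// scale1r opprB addrC subrK.
  rewrite lee_fin -[_ *: _]add0r dotvDZr [X in X + _](_ : _ = 0); last first.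
    by apply: big1 => j _; rewrite mxE mulr0.
  by rewrite add0r ler_pdivrMl// mulrC.
rewrite mulr0 leNgt; apply/negP => wu0.
(* The supremum over the empty set is [-oo], so a finite one provides a unit direction. *)
have [v [[t t0 sv] v1]] : [set u | tangent_cone simplex la (- u) /\
    ('N[Pi]_2%:E[EFin \o mixture h u] = 1)%E] !=set0.
  apply/set0P/eqP => e0; move: alE.
  by rewrite /alignment e0 image_set0 ereal_sup0.
(* Directions of zero norm can be added freely to a unit direction of the
   cone, which makes the supremum infinite. *)
have le_a k : 0 < k -> dotv w v + k * dotv w (la - mu) <= a.
  move=> k0; rewrite -dotvDZr -lee_fin -alE; apply: ereal_sup_ubound.
  exists (v + k *: (la - mu)) => //; split; last first.
    apply/Lnorm2_eq1; rewrite sqnormD_null; first exact/Lnorm2_eq1.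
    by rewrite uc expr0n.
  have tk : 0 < 1 + t * k by rewrite addr_gt0// mulr_gt0.
  have tkn0 : 1 + t * k != 0 by rewrite gt_eqF.
  (* This step length makes the endpoint the convex combination of [la - t *: v] and [mu] with
     weights [1 - p] and [p]. *)
  exists (t / (1 + t * k)); first by rewrite divr_gt0.
  pose p := t * k / (1 + t * k).
  have p01 : 0 <= p <= 1.
    have tk0 : 0 <= t * k by rewrite mulr_ge0// ltW.
    by rewrite /p ler_pdivrMr// mul1r lerDr ler01 andbT divr_ge0// ltW.
  have := simplex_convex p01 sv smu; congr simplex.
  by apply/rowP => j; rewrite !mxE /p; field.
(* With this [k] the left side of [le_a] is at least [a + 1]. *)
have := le_a ((`|a - dotv w v| + 1) / dotv w (la - mu)).
rewrite divfK ?gt_eqF// => /(_ (divr_gt0 (ltr_wpDl (normr_ge0 _) ltr01) wu0)).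
by have := ler_norm (a - dotv w v); lra.
Qed.

(** * Strong convexity of the risk at midpoints *)

Lemma risk_midpoint (R : realType) (dO dS dT : measure_display)
    (Omega : measurableType dO) (S : measurableType dS)
    (T : measurableType dT) (Pr : probability Omega R)
    (X : {RV Pr >-> S}) (Y : {RV Pr >-> T}) (l : T -> R -> R) (r : R)
    (N : nat) (h : 'I_N -> {mfun S >-> R}) (la mu : 'rV[R]_N) :
  loss_function l -> 1 <= r -> 0 <= tau l r -> (forall j x, `|h j x| <= 1) ->
  simplex la -> simplex mu ->
  (2%:E * risk X Y l (mixture h (2^-1 *: (la + mu)))
     + (tau l r / 2)%:E * sqnorm h (distribution Pr X) (la - mu)
   <= risk X Y l (mixture h la) + risk X Y l (mixture h mu))%E.
Proof.
move=> lossl r1 t0 h1 sla smu.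
have l0 := loss_ge0 lossl.
have mrisk nu :
    measurable_fun setT (fun o => (l (Y o) (mixture h nu (X o)))%:E).
  apply/measurable_EFinP.
  apply: (measurableT_comp (loss_measurable lossl)
           (g := fun o => (Y o, mixture h nu (X o)))).
  apply: measurable_fun_pair => //.
  exact: (measurableT_comp (measurable_mixture h nu)).
have msq : measurable_fun setT (fun x => (mixture h (la - mu) x ^+ 2)%:E).
  by apply/measurable_EFinP; apply: measurable_funX; exact: measurable_mixture.
have msqX : measurable_fun setT (fun o => (mixture h (la - mu) (X o) ^+ 2)%:E).
  exact: (measurableT_comp msq).
(* Pulling the seminorm back to [Omega] puts every term under one integral; as the integrands are
   nonnegative, infinite risks are allowed. *)
rewrite /risk !unlock /sqnorm ge0_integral_distribution//; last first.
  by move=> x; rewrite lee_fin sqr_ge0.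
rewrite -!ge0_integralZl_EFin//; last 3 first.
- by move=> o _; rewrite lee_fin sqr_ge0.
- by rewrite divr_ge0.
- by move=> o _; rewrite lee_fin.
rewrite -!ge0_integralD//; last 6 first.
- by move=> o _; rewrite lee_fin.
- by move=> o _; rewrite lee_fin.
- by move=> o _; rewrite -EFinM lee_fin mulr_ge0.
- exact: measurable_funeM.
- by move=> o _; rewrite -EFinM lee_fin mulr_ge0 ?sqr_ge0// divr_ge0.
- exact: measurable_funeM.
apply: ge0_le_integral => //.
- move=> o _; rewrite -!EFinM -EFinD lee_fin addr_ge0// mulr_ge0 ?sqr_ge0//.
  by rewrite divr_ge0.
- by apply: emeasurable_funD; exact: measurable_funeM.
- exact: emeasurable_funD.
move=> o _; rewrite -!EFinM -!EFinD lee_fin /=.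
have -> : mixture h (2^-1 *: (la + mu)) (X o) =
    (mixture h la (X o) + mixture h mu (X o)) / 2.
  rewrite scalerDr -[2^-1 *: la]add0r !mixtureDZ.
  rewrite [X in X + _ + _](_ : _ = 0); first by lra.
  by apply: big1 => j _; rewrite mxE mul0r.
have -> : mixture h (la - mu) (X o) = mixture h la (X o) - mixture h mu (X o).
  by rewrite -scaleN1r mixtureDZ mulN1r.
(* Both mixtures take values in [-1, 1], within the range that [tau l r] controls. *)
by apply: loss_midpoint => //; apply: le_trans r1; exact: mixture_le1.
Qed.

(** * The oracle inequality *)

Theorem theorem4 (R : realType) (dT : measure_display) (T : measurableType dT)
    (l : T -> R -> R) (M : R) :
  loss_function l ->
  0 < tau l (Num.max M 1) ->
  exists2 C : R, 0 < C &
    forall (dO dS : measure_display) (Omega : measurableType dO)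
      (S : measurableType dS) (Pr : probability Omega R)
      (X : {RV Pr >-> S}) (Y : {RV Pr >-> T})
      (N : nat) (h : 'I_N -> {mfun S >-> R}) (fstar : S -> R),
    (forall j x, `|h j x| <= 1) ->
    risk_minimizer X Y l fstar ->
    fstar \in Lfun (distribution Pr X) 2%:E ->
    ('N[distribution Pr X]_+oo[EFin \o fstar] <= M%:E)%E ->
    forall (eps : R) (leps la : 'rV[R]_N),
    0 < eps ->
    penalized_minimizer h X Y l eps leps ->
    simplex la ->
    (excess_risk X Y l fstar (mixture h leps)
       + (2 * eps * \sum_(j | j \notin supp la) leps 0 j)%:E
     <= 3%:E * excess_risk X Y l fstar (mixture h la)
       + C%:E * ((eps ^+ 2)%:E * alphaN h (distribution Pr X) la ^+ 2
                 + (eps / N%:R)%:E))%E.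
Proof.
move=> lossl; set r := Num.max M 1; set t := tau l r => t0.
(* The 2 pays for the [2 / N] of the entropy bound, and [1 / (2 * t)] for completing the square in
   [peter_paul]. *)
have C0 : 0 < 2 + 1 / (2 * t) by rewrite addr_gt0// divr_gt0// mulr_gt0.
exists (2 + 1 / (2 * t)) => // dO dS Omega S Pr X Y N h fstar h1.
move=> [_ fmin] _ _ eps le la eps0 [sle lemin] sla.
set al := alphaN _ _ _; set s := \sum_(j | _) _.
pose mid := 2^-1 *: (la + le).
have smid : simplex mid.
  have h01 : 0 <= (2^-1 : R) <= 1 by lra.
  have := simplex_convex h01 sla sle; congr simplex.
  by apply/rowP => j; rewrite !mxE; lra.
have risk_ge0 f : (0 <= risk X Y l f)%E.
  by rewrite /risk unlock; apply: integral_ge0 => o _; rewrite lee_fin loss_ge0.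
have r1 : 1 <= r by rewrite le_max lexx orbT.
have strong := risk_midpoint X Y lossl r1 (ltW t0) h1 sla sle.
have entr := entropy_midpoint sla sle.
have q0 : (0 <= sqnorm h (distribution Pr X) (la - le))%E.
  by apply: integral_ge0 => x _; rewrite lee_fin sqr_ge0.
have opt := lemin _ smid; have optla := lemin _ sla.
have fla := fmin _ (measurable_mixture h la).
move: opt optla fla strong (risk_ge0 (mixture h la)) (risk_ge0 (mixture h le))
  (risk_ge0 (mixture h mid)) (risk_ge0 fstar).
rewrite /excess_risk /penalized_risk -/mid.
(* If the minimal risk is [+oo], subtracting it makes the left side [-oo]. *)
case: (risk X Y l fstar) => [c| |]//=; last by rewrite addeNy addNye leNye.
have al2_ge0 : (0 <= al * al)%E by rewrite -expe2 sqre_ge0.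
have rem_ge0 : (0 <= (2 + 1 / (2 * t))%:E *
    ((eps ^+ 2)%:E * (al * al) + (eps / N%:R)%:E))%E.
  rewrite mule_ge0 ?lee_fin ?(ltW C0)// adde_ge0//.
    by rewrite mule_ge0 ?lee_fin ?sqr_ge0.
  by rewrite lee_fin divr_ge0// ltW.
case: (risk X Y l (mixture h la)) => [a| |]//=; last first.
  move=> *; rewrite addye// gt0_muley ?lte_fin// addye ?leey//.
  by rewrite -ltNye (lt_le_trans _ rem_ge0).
case: (risk X Y l (mixture h le)) => [b| |]//=.
(* An infinite midpoint risk, or below an infinite seminorm, would contradict [strong], whose right
   side is now finite. *)
case: (risk X Y l (mixture h mid)) => [m| |]//=; last first.
  move=> _ _ _; rewrite gt0_muley ?lte_fin// addye//.
  by rewrite -ltNye (lt_le_trans _ (mule_ge0 _ q0))// lee_fin divr_ge0// ltW.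
move: q0; case qE : (sqnorm _ _ _) => [q| |]// q0; last first.
  by move=> _ _ _; rewrite gt0_muley ?lte_fin ?divr_gt0// addey.
move=> opt _ ca strong _ _ _ _.
have rem_oo x : (x%:E <= 3 * (a%:E + (- c)%:E) +
   (2 + 1 / (2 * t))%:E * ((eps ^+ 2)%:E * +oo + (eps / N%:R)%:E))%E.
  rewrite gt0_muley ?lte_fin ?exprn_gt0// addye// gt0_muley ?lte_fin//.
  by rewrite addey ?leey.
(* Both infinite values of [al] have square [+oo]. *)
case alE : al => [e| |]; [|exact: rem_oo|exact: rem_oo].
have qsq : q = Num.sqrt q ^+ 2 by rewrite sqr_sqrtr.
have de : dotv (sN la) (la - le) <= e * Num.sqrt q.
  by apply: alignment_ub alE _ => //; rewrite ?sqrtr_ge0// qE -qsq.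
move: qsq de; set k := Num.sqrt q; clearbody k => qsq de.
move: opt ca strong entr; rewrite -!EFinM -!EFinD !lee_fin -/mid -/s -/t.
rewrite qsq; set Hm := entropy mid; set He := entropy le.
set D := dotv _ _ in de *; clearbody Hm He D s => opt ca strong entr.
have peter_paul : eps * (e * k) <=
    t / 2 * k ^+ 2 + 1 / (2 * t) * eps ^+ 2 * (e * e).
  rewrite -subr_ge0 [leRHS](_ : _ = (t * k - eps * e) ^+ 2 / (2 * t)).
    by rewrite divr_ge0 ?sqr_ge0// mulr_ge0// ltW.
  by field; rewrite gt_eqF.
have := ler_wpM2l (ltW eps0) entr.
have := ler_wpM2l (ltW eps0) de.
have e2 : 0 <= eps ^+ 2 * (e * e) by rewrite mulr_ge0 ?sqr_ge0// -expr2 sqr_ge0.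
have n0 : 0 <= 1 / (2 * t) * (eps / N%:R).
  by apply: mulr_ge0; apply: divr_ge0; rewrite ?ler0n//; lra.
(* Twice [opt] plus [strong], with the entropy, alignment and square bounds, gives the claim with
   factor 1 on the excess risk; [ca] raises it to 3, and [e2] and [n0] cover the surplus terms of
   the constant. *)
lra.
Qed.
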